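(* Let $G=(\mathbb{N}_0,w)$ be a physical linear graph and let $\rho$ be an intrinsic metric on $G$. For $n\in\mathbb{N}_0$ let $K(n)=\mathcal{K}_{G,n}(\infty)=\sup\{K\in\mathbb{R}:\mathrm{CD}(K,\infty,n)\text{ holds}\}$ and let $K(n)_-=\max\{-K(n),0\}$. Suppose that $$K(n)_-\in\mathcal{O}(\rho(n,0)^2)\quad\text{as } n\to\infty.$$ Then $G$ is stochastically complete.
   Context: A weighted graph $G=(V,E,w,m)$ is a connected, undirected, simple, locally finite graph $(V,E)$ with vertex weights $m:V\to(0,\infty)$ and symmetric edge weights $w:E\to(0,\infty)$, $w(x,y)=w(y,x)$ (with $w(x,y)=0$ if $x\not\sim y$). It is physical if $m\equiv 1$. A linear graph on $\mathbb{N}_0=\{0,1,2,\dots\}$ has vertex set $V=\mathbb{N}_0$ and edge set $E=\{\{n,n+1\}: n\in\mathbb{N}_0\}$. The Laplacian is $\Delta f(x)=\frac1{m(x)}\sum_{y\sim x}w(x,y)(f(y)-f(x))$ for $f:V\to\mathbb{R}$. Set $\Gamma(f,g)=\frac12(\Delta(fg)-f\Delta g-g\Delta f)$, $\Gamma(f)=\Gamma(f,f)$, and $\Gamma_2(f)=\frac12\Delta\Gamma(f)-\Gamma(f,\Delta f)$. For $K\in\mathbb{R}$, $D\in(0,\infty]$ (with $1/\infty=0$) and $x\in V$, the condition $\mathrm{CD}(K,D,x)$ means $\Gamma_2(f)(x)\ge\frac1D(\Delta f(x))^2+K\,\Gamma(f)(x)$ for all $f:V\to\mathbb{R}$. An intrinsic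 metric is a pseudo metric $\rho:V\times V\to[0,\infty)$ (symmetric, zero on the diagonal, triangle inequality) with $\sum_{y\sim x}w(x,y)\rho(x,y)^2\le m(x)$ for all $x\in V$. $G$ is stochastically complete if the minimal heat semigroup $P_t=e^{t\Delta}$ (associated with the Dirichlet Laplacian on $\ell^2(V,m)$ and extended to $\ell^\infty(V)$, equivalently the monotone limit of the heat semigroups with Dirichlet boundary conditions on an exhaustion of $V$ by finite sets) satisfies $P_t1=1$ for all $t>0$. A known criterion (Keller–Lenz) which may be used: a physical linear graph on $\mathbb{N}_0$ is stochastically complete if and only if $\sum_{n}\frac{n}{w(n,n+1)}=\infty$. *)

(* Defs.v *)
From HB Require Import structures.
From mathcomp Require Import all_boot all_order all_algebra.
From mathcomp Require Import all_classical all_reals all_analysis.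
Set Implicit Arguments.
Unset Strict Implicit.
Unset Printing Implicit Defensive.
Import Order.TTheory GRing.Theory Num.Theory.
Import numFieldNormedType.Exports.
Local Open Scope classical_set_scope.
Local Open Scope ring_scope.

Record weighted_graph (R : realType) (V : choiceType) := WeightedGraph {
  adj : rel V;
  adj_irr : irreflexive adj;
  adj_sym : symmetric adj;
  adj_connected : forall x y : V, exists2 p : seq V, path adj x p & y = last x p;
  adj_finite : forall x : V, finite_set [set y | adj x y];
  weight : V -> V -> R;
  weight_sym : forall x y : V, weight x y = weight y x;
  weight_gt0 : forall x y : V, adj x y -> 0 < weight x y;
  weight_eq0 : forall x y : V, ~~ adj x y -> weight x y = 0;
  vmass : V -> R;
  vmass_gt0 : forall x : V, 0 < vmass x
}.

Section GraphTheory.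
Context {R : realType} {V : choiceType}.
Implicit Types (G : weighted_graph R V) (f g : V -> R) (x : V).

Definition physical G := forall x, vmass G x = 1.

Definition laplacian G f : V -> R := fun x =>
  (vmass G x)^-1 * \sum_(y \in [set y | adj G x y]) weight G x y * (f y - f x).

Definition Gamma G f g : V -> R := fun x =>
  2^-1 * (laplacian G (f \* g) x - f x * laplacian G g x
          - g x * laplacian G f x).

Definition Gamma2 G f : V -> R := fun x =>
  2^-1 * laplacian G (Gamma G f f) x - Gamma G f (laplacian G f) x.

(* The dimension D ranges over ]0, +oo]; [fine D^-1] is 1/D, with 1/oo = 0. *)
Definition CD G (K : R) (D : \bar R) x := forall f,
  fine (D^-1)%E * (laplacian G f x) ^+ 2 + K * Gamma G f f x <= Gamma2 G f x.

(* The supremum is taken in the extended reals, so that no default value is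
   involved. *)
Definition curvature G (D : \bar R) x : \bar R :=
  ereal_sup [set K%:E | K in [set K : R | CD G K D x]].

Definition intrinsic_metric G (rho : V -> V -> R) :=
  [/\ forall x y, 0 <= rho x y,
      forall x, rho x x = 0,
      forall x y, rho x y = rho y x,
      forall x y z, rho x z <= rho x y + rho y z &
      forall x, \sum_(y \in [set y | adj G x y]) weight G x y * rho x y ^+ 2
                <= vmass G x].

(* The compression of the Laplacian to functions vanishing off A. *)
Definition dirichlet_laplacian G (A : set V) f : V -> R :=
  \1_A \* laplacian G (\1_A \* f).

(* exp (t Delta_A) applied to f 1_A, by the exponential series. *)
Definition dirichlet_heat G (A : set V) (t : R) f : V -> R := fun x =>
  limn (series (fun k =>
    t ^+ k / k`!%:R * iter k (dirichlet_laplacian G A) (\1_A \* f) x)).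

Definition exhaustion (A : nat -> set V) :=
  [/\ forall n, finite_set (A n),
      forall n, A n `<=` A n.+1 &
      \bigcup_n A n = [set: V]].

(* P_t 1 is the monotone limit of the Dirichlet semigroups along an exhaustion;
   it does not depend on the exhaustion, and one exists because a connected
   locally finite graph is countable. *)
Definition stochastically_complete G :=
  forall A : nat -> set V, exhaustion A ->
  forall t : R, 0 < t -> forall x,
  dirichlet_heat G (A n) t (cst 1) x @[n --> \oo] --> (1 : R).

End GraphTheory.

Definition linear_graph {R : realType} (G : weighted_graph R nat) :=
  forall i j : nat, adj G i j = (j == i.+1) || (i == j.+1).

(* Main.v *)
Require Import Defs.
From mathcomp Require Import all_boot all_order all_algebra finmap.
From mathcomp Require Import all_classical all_reals all_analysis.
From mathcomp Require Import ring lra.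
Set Implicit Arguments.
Unset Strict Implicit.
Import Order.TTheory GRing.Theory Num.Theory.
Import numFieldNormedType.Exports.
Local Open Scope classical_set_scope.
Local Open Scope ring_scope.

(* Write e_k for the weight of the edge {k, k+1}. Testing CD(-K, oo) on piecewise
   linear functions with the slopes 1 / e_k and 1 / e_(k-1) on the two sides of k
   shows that the defects D_k = e_(k+1) + e_(k-1) - 2 e_k - 2 K satisfy
   e_(k-1) D_k + e_k D_(k-1) <= 0. Hence e_k - max(-D_k, 0) / 2 - K k^2 is
   concave in k, so that e_n = O(n^2 (1 + K)) with K the curvature bound up to n.
   Since rho(n, 0) is at most the sum r_n of the e_j^(-1/2) for j < n, this gives
   e_n^(1/2) = O(n (1 + r_n)). It follows first that r_n is unbounded, because
   (1 + r_n)^2 grows at least like log n, and then that the partial sums v of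
   (k+1) / e_k are unbounded, because they grow at least like log (1 + r_n).
   As v tends to infinity and its Laplacian is 1, Khasminskii's criterion applies;
   it comes from the discrete maximum principle for the Euler scheme
   (1 + t L / n)^n, which converges to the Dirichlet heat semigroup. *)

(** * Convergence of the Euler scheme to the exponential series *)

Lemma binomial_le_expn_fact (R : realFieldType) (n k : nat) (t : R) :
  0 <= t -> 'C(n, k)%:R * (t / n%:R) ^+ k <= t ^+ k / k`!%:R.
Proof.
move=> t0; case: n => [|n].
  case: k => [|k]; first by rewrite bin0 !expr0 fact0 divr1 mulr1.
  by rewrite bin0n mul0r mulr_ge0// ?exprn_ge0// invr_ge0 ler0n.
rewrite expr_div_n mulrCA ler_wpM2l ?exprn_ge0//.
rewrite ler_pdivrMr ?exprn_gt0 ?ltr0n// mulrC ler_pdivlMr ?ltr0n ?fact_gt0//.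
(* Without denominators, the claim is that a falling factorial is at most the corresponding
   power. *)
rewrite -natrM -natrX ler_nat bin_ffact.
elim: k => [|k IH]; first by rewrite ffactn0.
by rewrite ffactnSr expnSr leq_mul// leq_subr.
Qed.

(** With [q = z / n], the inequality [1 + x <= expR x] at [x = q] and at [x = - q / (1 + q)]
    squeezes [1 + q] between [expR (q / (1 + q))] and [expR q]; then take [n]-th powers. *)
Lemma cvg_euler_expR (R : realType) (z : R) :
  0 <= z -> (1 + z / n%:R) ^+ n @[n --> \oo] --> expR z.
Proof.
move=> z0.
have zn : z / n%:R @[n --> \oo] --> (0 : R).
  rewrite -(mulr0 z); apply: cvgM; first exact: cvg_cst.
  apply/gtr0_cvgV0; last exact: cvgr_idn.
  by near=> n; rewrite ltr0n; near: n; exact: nbhs_infty_gt.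
have lo1 : z / (1 + z / n%:R) @[n --> \oo] --> z * (1 + 0)^-1.
  apply: cvgM; first exact: cvg_cst.
  apply: cvgV; first by rewrite addr0 oner_neq0.
  by apply: cvgD => //; exact: cvg_cst.
rewrite addr0 invr1 mulr1 in lo1.
have lo : expR (z / (1 + z / n%:R)) @[n --> \oo] --> expR z.
  by apply: (cvg_comp _ _ lo1); exact: continuous_expR.
apply: (squeeze_cvgr _ lo (cvg_cst _)); near=> n.
have n0 : 0 < n%:R :> R by rewrite ltr0n; near: n; exact: nbhs_infty_gt.
have q0 : 0 <= z / n%:R by rewrite divr_ge0// ltW.
have -> : z / (1 + z / n%:R) = n%:R * ((z / n%:R) / (1 + z / n%:R)).
  by field; rewrite !gt_eqF//= addrC ltr_wpDl.
have zE : expR z = expR (z / n%:R) ^+ n.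
  by rewrite -expRM_natl mulrC divfK// gt_eqF.
rewrite zE expRM_natl; set q := z / n%:R in q0 *.
have q1 : 0 < 1 + q by rewrite ltr_wpDr.
apply/andP; split; apply: lerXn2r; rewrite ?nnegrE ?expR_ge0 ?(ltW q1)//.
  have := expR_ge1Dx (- (q / (1 + q))); rewrite expRN.
  have -> : 1 + - (q / (1 + q)) = (1 + q)^-1 by field; rewrite gt_eqF.
  by rewrite lef_pV2 ?posrE// expR_gt0.
exact: expR_ge1Dx.
Unshelve. all: by end_near. Qed.

(* As [|a k| <= c ^+ k], the difference with the Taylor polynomial is at most
   the same difference for [a k = c ^+ k], where the sums are known. *)
Lemma cvg_euler_series (R : realType) (a : nat -> R) (c t : R) :
  0 <= c -> 0 <= t -> (forall k, `|a k| <= c ^+ k) ->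
  (\sum_(k < n.+1) 'C(n, k)%:R * (t / n%:R) ^+ k * a k) @[n --> \oo] -->
  limn (series (fun k => t ^+ k / k`!%:R * a k)).
Proof.
move=> c0 t0 ac; set b := fun k => _ * _.
have cE k : t ^+ k / k`!%:R * c ^+ k = exp_coeff (t * c) k.
  by rewrite /exp_coeff/= exprMn mulrAC.
have tk k : 0 <= t ^+ k / k`!%:R by rewrite divr_ge0 ?exprn_ge0 ?ler0n.
have cb : cvgn (series b).
  apply: normed_cvg; apply: (series_le_cvg _ _ _ (is_cvg_series_exp_coeff (t * c))).
  - by move=> n; exact: normr_ge0.
  - by move=> n; apply: exp_coeff_ge0; rewrite mulr_ge0.
  - by move=> n /=; rewrite /b normrM ger0_norm// -cE ler_wpM2l.
have cb1 : (series b n.+1) @[n --> \oo] --> limn (series b).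
  by have := cb; rewrite -(cvg_shiftS (series b)).
have e1 : (expR (t * c) - (1 + t * c / n%:R) ^+ n) @[n --> \oo] --> (0 : R).
  rewrite -(subrr (expR (t * c))); apply: cvgB; first exact: cvg_cst.
  by apply: cvg_euler_expR; rewrite mulr_ge0.
have d0 : (series b n.+1 - \sum_(k < n.+1) 'C(n, k)%:R * (t / n%:R) ^+ k * a k)
    @[n --> \oo] --> (0 : R).
  apply/norm_cvg0P; apply: (squeeze_cvgr _ (cvg_cst 0) e1); near=> n.
  rewrite normr_ge0 /series/= big_mkord -sumrB.
  apply: (le_trans (ler_norm_sum _ _ _)).
  apply: (@le_trans _ _ (\sum_(k < n.+1) (t ^+ k / k`!%:R * c ^+ k -
      'C(n, k)%:R * (t / n%:R) ^+ k * c ^+ k))).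
    apply: ler_sum => k _; rewrite /b -!mulrBl normrM.
    by rewrite ger0_norm ?ler_wpM2l// subr_ge0 binomial_le_expn_fact.
  rewrite sumrB lerB//.
    rewrite (eq_bigr (fun k : 'I__ => exp_coeff (t * c) k)) => [|k _]; last exact: cE.
    rewrite -(big_mkord xpredT (exp_coeff (t * c))).
    apply: (@nondecreasing_cvgn_le _ (series (exp_coeff (t * c)))).
      apply: nondecreasing_series => k _ _.
      by apply: exp_coeff_ge0; rewrite mulr_ge0.
    exact: is_cvg_series_exp_coeff.
  rewrite addrC exprD1n le_eqVlt; apply/orP; left; apply/eqP.
  apply: eq_bigr => k _; rewrite [t * c / _]mulrAC exprMn.
  by rewrite -mulr_natl mulrA.
have := cvgB cb1 d0; rewrite subr0.
under eq_cvg do rewrite opprB addrC subrK.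
exact.
Unshelve. all: by end_near. Qed.

(** * Dirichlet Laplacian, discrete maximum principle and Khasminskii's criterion *)

Section Dirichlet.
Context {R : realType} {V : choiceType}.
Implicit Types (G : weighted_graph R V) (A : set V) (f g h v : V -> R).

Definition degree G x :=
  (vmass G x)^-1 * \sum_(y \in [set y | adj G x y]) weight G x y.

Lemma laplacianE G f x : laplacian G f x =
  (vmass G x)^-1 * \sum_(y <- fset_set [set y | adj G x y])
                     weight G x y * (f y - f x).
Proof. by rewrite /laplacian fsbig_finite//; exact: adj_finite. Qed.

Lemma mem_adj G x y : y \in fset_set [set y | adj G x y] -> adj G x y.
Proof. by have xf := adj_finite G x; rewrite in_fset_set ?inE. Qed.

Lemma vmassV_ge0 G x : 0 <= (vmass G x)^-1.
Proof. by rewrite invr_ge0 ltW// vmass_gt0. Qed.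

Lemma degree_ge0 G x : 0 <= degree G x.
Proof.
rewrite mulr_ge0 ?vmassV_ge0// fsumr_ge0// => y xy.
by rewrite ltW// weight_gt0.
Qed.

(** Cancelling the diagonal of the Laplacian leaves nonnegative coefficients, the source of the
    monotonicity of the Euler step. *)
Lemma laplacianB_degree G f x : laplacian G f x + degree G x * f x =
  (vmass G x)^-1 * \sum_(y <- fset_set [set y | adj G x y]) weight G x y * f y.
Proof.
rewrite laplacianE /degree fsbig_finite; last exact: adj_finite.
rewrite -mulrA -mulrDr; congr *%R; rewrite mulr_suml -big_split/=.
by apply: eq_bigr => y _; ring.
Qed.

Lemma laplacian_le G f g x : f x = g x -> (forall y, adj G x y -> f y <= g y) ->
  laplacian G f x <= laplacian G g x.
Proof.
move=> fg le_fg; rewrite !laplacianE ler_wpM2l ?vmassV_ge0// fg.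
rewrite big_seq [leRHS]big_seq ler_sum// => y /mem_adj xy.
by rewrite ler_wpM2l ?lerB ?le_fg// ltW// weight_gt0.
Qed.

Lemma laplacian_linear G c f g x : laplacian G (fun y => c * f y + g y) x =
  c * laplacian G f x + laplacian G g x.
Proof.
rewrite !laplacianE mulrCA -mulrDr; congr *%R.
by rewrite mulr_sumr -big_split/=; apply: eq_bigr => y _; ring.
Qed.

Lemma laplacian_cst G c x : laplacian G (fun=> c) x = 0.
Proof. by rewrite laplacianE big1 ?mulr0// => y _; rewrite subrr mulr0. Qed.

Lemma dirichlet_laplacian_linear G A c f g x :
  dirichlet_laplacian G A (fun y => c * f y + g y) x =
  c * dirichlet_laplacian G A f x + dirichlet_laplacian G A g x.
Proof.
rewrite /dirichlet_laplacian/= [c * _]mulrCA -mulrDr -laplacian_linear.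
by congr (_ * laplacian G _ x); apply/funext => y /=; ring.
Qed.

Definition dirichlet_euler G A (tau : R) f : V -> R := fun x =>
  tau * dirichlet_laplacian G A f x + f x.

Lemma iter_dirichlet_laplacian_linear G A c f g k x :
  iter k (dirichlet_laplacian G A) (fun y => c * f y + g y) x =
  c * iter k (dirichlet_laplacian G A) f x + iter k (dirichlet_laplacian G A) g x.
Proof.
elim: k x => //= k IH x.
rewrite -dirichlet_laplacian_linear; congr (dirichlet_laplacian G A _ x).
exact/funext.
Qed.

(** The binomial theorem for the identity plus [tau] times the Dirichlet Laplacian, by induction
    with Pascal's rule. *)
Lemma iter_dirichlet_euler G A tau f n x : iter n (dirichlet_euler G A tau) f x =
  \sum_(k < n.+1) 'C(n, k)%:R * tau ^+ k * iter k (dirichlet_laplacian G A) f x.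
Proof.
elim: n f => [|n IH] f; first by rewrite big_ord1 bin0 expr0 !mul1r.
rewrite iterSr IH.
transitivity (\sum_(k < n.+1) ('C(n, k)%:R * tau ^+ k.+1 *
     iter k.+1 (dirichlet_laplacian G A) f x)
  + \sum_(k < n.+1) 'C(n, k)%:R * tau ^+ k * iter k (dirichlet_laplacian G A) f x).
  rewrite -big_split/=; apply: eq_bigr => k _.
  by rewrite /dirichlet_euler iter_dirichlet_laplacian_linear -iterSr exprS /=; ring.
pose F m k := 'C(m, k)%:R * tau ^+ k * iter k (dirichlet_laplacian G A) f x.
(* The added term is zero, since ['C(n, n.+1) = 0]; it aligns the two sums for Pascal's rule. *)
rewrite (_ : \sum_(k < n.+1) F n k = \sum_(k < n.+2) F n k); last first.
  by rewrite [RHS]big_ord_recr /F/= bin_small// !mul0r addr0.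
rewrite -/(F n.+1 _) [in RHS]big_ord_recl [X in _ + X]big_ord_recl addrCA.
rewrite /F !bin0; congr +%R; rewrite -big_split/=; apply: eq_bigr => i _.
by rewrite /bump/= !add1n binS natrD; ring.
Qed.

(** Differences of values are at most [2 * M]. Iterating yields the geometric bound that
    [cvg_euler_series] requires. *)
Lemma dirichlet_laplacian_bound G A f (d M : R) :
  (forall x, A x -> degree G x <= d) -> 0 <= d -> (forall x, `|f x| <= M) ->
  forall x, `|dirichlet_laplacian G A f x| <= 2 * d * M.
Proof.
move=> Ad d0 fM x; have M0 : 0 <= M by apply: le_trans (fM x).
rewrite /dirichlet_laplacian/= indicE.
have [Ax|nAx] := boolP (x \in A); last by rewrite mul0r normr0 !mulr_ge0.
have fA y : `|(\1_A \* f) y| <= M.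
  rewrite /= indicE; case: (_ \in _); first by rewrite mul1r.
  by rewrite mul0r normr0.
rewrite mul1r laplacianE normrM (ger0_norm (vmassV_ge0 _ _)).
apply: (@le_trans _ _ (degree G x * (M + M))); last first.
  have : degree G x * M <= d * M by rewrite ler_wpM2r// Ad// -inE.
  lra.
rewrite /degree -mulrA ler_wpM2l ?vmassV_ge0// fsbig_finite; last exact: adj_finite.
apply: (le_trans (ler_norm_sum _ _ _)); rewrite mulr_suml.
rewrite big_seq [leRHS]big_seq ler_sum// => y /mem_adj xy.
have w0 := ltW (weight_gt0 xy).
by rewrite normrM ger0_norm// ler_wpM2l// (le_trans (ler_normB _ _))// lerD.
Qed.

(** The step size condition makes every coefficient of the Euler step nonnegative: the diagonal one
    contains [1 - tau * degree G x], the others are multiples of weights. *)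
Lemma dirichlet_euler_homo G A (tau : R) f g : 0 <= tau ->
  (forall x, A x -> tau * degree G x <= 1) ->
  (forall x, f x <= g x) ->
  forall x, dirichlet_euler G A tau f x <= dirichlet_euler G A tau g x.
Proof.
move=> tau0 Atau fg x; rewrite /dirichlet_euler /dirichlet_laplacian/= indicE.
have [Ax|nAx] := boolP (x \in A); last by rewrite !mul0r !mulr0 !add0r.
rewrite !mul1r; move: Ax; rewrite inE => Ax.
have E h : tau * laplacian G (\1_A \* h) x + h x =
    tau * (laplacian G (\1_A \* h) x + degree G x * h x) +
    (1 - tau * degree G x) * h x by ring.
have A1 h : (\1_A \* h) x = h x by rewrite /= indicE mem_set// mul1r.
rewrite E [leRHS]E -{1}(A1 f) -{1}(A1 g) !laplacianB_degree lerD//; last first.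
  by rewrite ler_wpM2l// subr_ge0 Atau.
rewrite ler_wpM2l// ler_wpM2l ?vmassV_ge0// big_seq [leRHS]big_seq.
apply: ler_sum => y /mem_adj xy; rewrite ler_wpM2l//= ?(ltW (weight_gt0 xy))//.
by rewrite ler_wpM2l// indicE ler0n.
Qed.

(** On [A] the function [\1_A] attains its maximum, so its Laplacian there is at most 0 and one
    Euler step does not increase it; monotonicity propagates this. *)
Lemma iter_dirichlet_euler_le1 G A (tau : R) : 0 <= tau ->
  (forall x, A x -> tau * degree G x <= 1) ->
  forall n x, iter n (dirichlet_euler G A tau) \1_A x <= \1_A x.
Proof.
move=> tau0 Atau; elim=> [|n IH] x; first exact: lexx.
rewrite iterS; apply: le_trans (dirichlet_euler_homo tau0 Atau IH x) _.
rewrite /dirichlet_euler -[leRHS]add0r lerD2r.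
rewrite mulr_ge0_le0// /dirichlet_laplacian/= indicE.
have [Ax|nAx] := boolP (x \in A); last by rewrite mul0r.
rewrite mul1r -(laplacian_cst G 1 x).
apply: laplacian_le => [|y _] /=; rewrite -expr2 indicE ?Ax ?expr1n//.
by rewrite -natrX lern1; case: (_ \in _).
Qed.

(* The discrete maximum principle, with the barrier [1 - (v + j * tau) / M]. *)
Lemma iter_dirichlet_euler_ge G A (tau M : R) v : 0 <= tau -> 0 < M ->
  (forall x, A x -> tau * degree G x <= 1) ->
  (forall x, 0 <= v x) -> (forall x, laplacian G v x <= 1) ->
  (forall x, ~ A x -> M <= v x) ->
  forall n x, \1_A x * (1 - (v x + n%:R * tau) / M) <=
              iter n (dirichlet_euler G A tau) \1_A x.
Proof.
move=> tau0 M0 Atau v0 v1 Mv.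
pose phi n x := 1 - (v x + n%:R * tau) / M.
suff : forall n x, \1_A x * phi n x <= iter n (dirichlet_euler G A tau) \1_A x by [].
elim=> [|n IH] x.
  rewrite -[leRHS]mulr1 ler_wpM2l ?indicE ?ler0n//.
  by rewrite /phi gerDl oppr_le0 mul0r addr0 divr_ge0// ltW.
rewrite iterS; apply: le_trans (dirichlet_euler_homo tau0 Atau IH x).
rewrite /dirichlet_euler /dirichlet_laplacian/=.
have [Ax|nAx] := boolP (x \in A); last first.
  by rewrite indicE (negbTE nAx) !mul0r mulr0 addr0.
have AA y : (\1_A y : R) * (\1_A y * phi n y) = \1_A y * phi n y.
  by rewrite mulrA -expr2 indicE; case: (_ \in _); rewrite ?expr1n ?expr0n.
have -> : laplacian G (\1_A \* (fun y => \1_A y * phi n y)) x =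
          laplacian G (fun y => \1_A y * phi n y) x.
  by congr laplacian; apply/funext => y /=; exact: AA.
(* Off [A], [M <= v] makes [phi n] nonpositive, so truncation to [A] only raises the values at
   neighbours of [x] and keeps the value at [x]. *)
have lap : - M^-1 <= laplacian G (fun y => \1_A y * phi n y) x.
  have phiE : phi n = fun y => - M^-1 * v y + (1 - n%:R * tau / M).
    by apply/funext => y; rewrite /phi; ring.
  apply: (@le_trans _ _ (laplacian G (phi n) x)).
    rewrite phiE laplacian_linear laplacian_cst addr0 mulNr lerN2.
    by rewrite ler_piMr// invr_ge0 ltW.
  apply: laplacian_le => [|y _]; first by rewrite indicE Ax mul1r.
  rewrite indicE; have [Ay|nAy] := boolP (y \in A); first by rewrite mul1r.
  rewrite mul0r subr_le0 ler_pdivlMr// mul1r.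
  apply: (@le_trans _ _ (v y)); last by rewrite lerDl mulr_ge0.
  by apply: Mv => Ay; move: nAy; rewrite mem_set.
rewrite indicE Ax !mul1r.
have -> : phi n.+1 x = tau * (- M^-1) + phi n x by rewrite /phi -natr1; ring.
by rewrite lerD2r ler_wpM2l.
Qed.

Lemma finite_degree_bound G A : finite_set A ->
  exists2 d, 0 <= d & forall x, A x -> degree G x <= d.
Proof.
move=> Af; exists (\sum_(y \in A) degree G y).
  by apply: fsumr_ge0 => y _; exact: degree_ge0.
move=> x Ax; rewrite (fsbigD1 x)//= lerDl fsumr_ge0// => y _.
exact: degree_ge0.
Qed.

(** Both Euler estimates, with [n] steps of size [t / n], pass to the limit; the total time
    [n * (t / n) = t] enters the barrier. *)
Lemma dirichlet_heat1_bounds G A (t M : R) v : finite_set A ->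
  0 <= t -> 0 < M ->
  (forall x, 0 <= v x) -> (forall x, laplacian G v x <= 1) ->
  (forall x, ~ A x -> M <= v x) ->
  forall x, A x -> 1 - (v x + t) / M <= dirichlet_heat G A t (cst 1) x <= 1.
Proof.
move=> Af t0 M0 v0 v1 Mv x Ax.
have [d d0 dA] := finite_degree_bound G Af.
have A1 : \1_A \* cst 1 = \1_A :> (V -> R) by apply/funext => y /=; rewrite mulr1.
have AxE : \1_A x = 1 :> R by rewrite indicE mem_set.
have itb k y : `|iter k (dirichlet_laplacian G A) \1_A y| <= (2 * d) ^+ k.
  elim: k y => [|k IH] y.
    by rewrite /= indicE; case: (_ \in _); rewrite ?normr0 ?normr1.
  by rewrite iterS exprS; apply: dirichlet_laplacian_bound.
have cv := cvg_euler_series (mulr_ge0 (ler0n _ 2) d0) t0 (fun k => itb k x).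
rewrite /dirichlet_heat A1.
(* For [n] beyond [t * d] the step is small enough for monotonicity on [A]. *)
have tau n : (t * d < n%:R) -> 0 <= t / n%:R /\
    (forall x, A x -> t / n%:R * degree G x <= 1) /\ n%:R * (t / n%:R) = t.
  move=> tdn; have n0 : 0 < n%:R :> R by apply: le_lt_trans tdn; rewrite mulr_ge0.
  split; first by rewrite divr_ge0// ltW.
  split; last by rewrite mulrC divfK// gt_eqF.
  move=> y Ay; rewrite mulrAC ler_pdivrMr// mul1r (le_trans _ (ltW tdn))//.
  by rewrite ler_wpM2l// dA.
have big : \forall n \near \oo, t * d < n%:R.
  exact: nbhs_infty_gtr.
apply/andP; split.
  apply: (cvgr_to_ge cv); near=> n.
  rewrite -iter_dirichlet_euler.
  have [|n0 [nA nt]] := tau n; first by near: n.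
  have := iter_dirichlet_euler_ge n0 M0 nA v0 v1 Mv n x.
  by rewrite AxE mul1r nt.
apply: (cvgr_to_le cv); near=> n.
rewrite -iter_dirichlet_euler.
have [|n0 [nA nt]] := tau n; first by near: n.
by rewrite -[leRHS]AxE; exact: iter_dirichlet_euler_le1.
Unshelve. all: by end_near. Qed.

Lemma exhaustion_subset (A : nat -> set V) (B : set V) : exhaustion A ->
  finite_set B -> \forall n \near \oo, B `<=` A n.
Proof.
move=> [_ AS AT] /finite_fsetP[X ->].
have homoA m n : (m <= n)%N -> A m `<=` A n.
  move=> /subnK <-; elim: (n - m)%N => // k IH.
  exact: subset_trans IH (AS _).
have Ax x : \forall n \near \oo, A n x.
  have : (\bigcup_n A n) x by rewrite AT.
  by move=> [m _ Amx]; exists m => // n mn; exact: homoA mn _ Amx.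
suff : \forall n \near \oo, forall x, x \in (X : seq V) -> A n x by [].
elim: (X : seq V) => [|x s IH]; first by apply: nearW => n x.
near=> n => y; rewrite in_cons => /predU1P[->|].
  by near: n; exact: Ax.
by move: y; near: n; exact: IH.
Unshelve. all: by end_near. Qed.

(* Khasminskii's criterion. *)
Lemma stochastically_complete_exhausting G v :
  (forall x, 0 <= v x) -> (forall x, laplacian G v x <= 1) ->
  (forall M, finite_set [set x | v x < M]) -> stochastically_complete G.
Proof.
move=> v0 v1 vfin A exhA t t0 x.
apply/cvgrPdist_le => e e0.
(* This choice makes the error [(v x + t) / M] at most [e]. *)
set M := (v x + t) / e + 1; have [Afin _ _] := exhA.
have vt0 : 0 <= (v x + t) / e by rewrite divr_ge0 ?addr_ge0// ltW.
have M0 : 0 < M by rewrite ltr_wpDl.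
near=> n.
have An : [set y | v y < M] `<=` A n.
  by near: n; exact: exhaustion_subset.
have Ax : A n x.
  have : [set x] `<=` A n by near: n; apply: exhaustion_subset.
  exact.
have Mv y : ~ A n y -> M <= v y.
  by move=> nAy; rewrite leNgt; apply/negP => /An.
have /andP[lo up] := dirichlet_heat1_bounds (Afin n) (ltW t0) M0 v0 v1 Mv Ax.
rewrite ger0_norm ?subr_ge0// lerBlDr -lerBlDl (le_trans _ lo)// lerB//.
by rewrite ler_pdivrMr// /M mulrDr mulr1 mulrC divfK ?gt_eqF// lerDl ltW.
Unshelve. all: by end_near. Qed.
End Dirichlet.

(** * Quadratic growth of the weights from the defect inequalities *)

Section ConcavityDefect.
Context {R : realType}.
Implicit Types (w : nat -> R) (K : R).

(* The defect with index [k] is centred at [k.+1]. *)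
Definition defect w K k := w k.+2 + w k - 2 * w k.+1 - 2 * K.

Definition defect_neg w K k := Num.max (- defect w K k) 0.

Lemma defect_neg_ge w K k : - defect w K k <= defect_neg w K k.
Proof. by rewrite /defect_neg le_max lexx. Qed.

Lemma defect_neg_ge0 w K k : 0 <= defect_neg w K k.
Proof. by rewrite /defect_neg le_max lexx orbT. Qed.

(* A positive defect of index [k.+1] forces negative defects at both neighbours
   that are jointly at least twice as large. *)
Lemma defect_le w K k : 0 <= K -> (forall j, 0 < w j) ->
  w k.+1 * defect w K k.+1 + w k.+2 * defect w K k <= 0 ->
  w k.+2 * defect w K k.+2 + w k.+3 * defect w K k.+1 <= 0 ->
  2 * defect w K k.+1 <=
    defect_neg w K k + defect_neg w K k.+2 - 2 * defect_neg w K k.+1.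
Proof.
move=> K0 w0 h1 h2.
have [D0|D0] := leP (defect w K k.+1) 0.
  rewrite {3}/defect_neg (max_idPl _); last by rewrite oppr_ge0.
  have := defect_neg_ge0 w K k; have := defect_neg_ge0 w K k.+2; lra.
rewrite {3}/defect_neg (max_idPr _); last by rewrite oppr_le0 ltW.
have h3 := defect_neg_ge w K k; have h4 := defect_neg_ge w K k.+2.
rewrite mulr0 subr0 -(ler_pM2l (w0 k.+2)).
apply: (@le_trans _ _ (w k.+2 * (- defect w K k - defect w K k.+2))); last first.
  by rewrite ler_pM2l ?w0//; lra.
have : 0 <= defect w K k.+1 * (defect w K k.+1 + 2 * K).
  by apply: mulr_ge0; [exact: ltW|have := ltW D0; lra].
move: h1 h2; set D1 := defect w K k; set D3 := defect w K k.+2.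
set D2 := defect w K k.+1 => h1 h2.
have -> : D2 + 2 * K = w k.+3 + w k.+1 - 2 * w k.+2 by rewrite /D2 /defect; ring.
lra.
Qed.

(** Slopes of a concave sequence decrease, so every increment from [m] to [N] is at most the
    first. *)
Lemma concave_le_tangent (u : nat -> R) m N : (m < N)%N ->
  (forall k, (m <= k)%N -> (k.+2 <= N)%N -> u k.+2 + u k <= 2 * u k.+1) ->
  u N <= u m + (N - m)%:R * (u m.+1 - u m).
Proof.
move=> mN cu.
have slope k : (m <= k)%N -> (k < N)%N -> u k.+1 - u k <= u m.+1 - u m.
  move=> /subnK <-; elim: (k - m)%N => // i IH iN.
  have := cu (i + m)%N (leq_addl _ _) iN.
  by have := IH (ltnW iN); rewrite addSn; lra.
have H i : (i + m <= N)%N -> u (i + m)%N <= u m + i%:R * (u m.+1 - u m).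
  elim: i => [|i IH] iN; first by rewrite add0n mul0r addr0.
  have := IH (ltnW iN); have := slope (i + m)%N (leq_addl _ _) iN.
  by rewrite addSn -natr1; lra.
by rewrite -{1}(subnK (ltnW mN)) H ?subnK ?(ltnW mN).
Qed.

Lemma quadratic_growth w K m N : 0 <= K -> (forall j, 0 < w j) -> (m < N)%N ->
  (forall k, (m <= k)%N -> (k < N)%N ->
     w k.+1 * defect w K k.+1 + w k.+2 * defect w K k <= 0) ->
  (forall k, (m <= k)%N -> (k < N)%N -> defect w K k <= 2 * w k.+1) ->
  w N.+1 <= 8 * (N.+1)%:R ^+ 2 * (w m.+1 + w m.+2 + 3 * K).
Proof.
move=> K0 w0 mN h1 h2.
(* The second difference of [w] is the defect plus [2 * K]. The quadratic term removes [2 * K], and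
   [defect_le] absorbs the defect. *)
pose u k := w k.+1 - defect_neg w K k / 2 - K * k%:R ^+ 2.
have uN : u N <= u m + (N - m)%:R * (u m.+1 - u m).
  apply: concave_le_tangent => // k mk kN; rewrite /u.
  have := defect_le K0 w0 (h1 k mk (ltnW kN)) (h1 k.+1 (leqW mk) kN).
  rewrite {1}/defect -[k.+2%:R]natr1 -[k.+1%:R]natr1.
  by move: (w k.+1) (w k.+2) (w k.+3) => a b c; lra.
(* This removes the unknown [defect_neg w K m] from the initial slope of [u]. *)
have Dm : defect_neg w K m <= 2 * K + 2 * w m.+1.
  rewrite /defect_neg ge_max /defect; apply/andP.
  have ? := w0 m; have ? := w0 m.+1; have ? := w0 m.+2.
  by split; lra.
have um : u m <= w m.+1.
  have : 0 <= K * m%:R ^+ 2 by rewrite mulr_ge0// exprn_ge0.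
  by have := defect_neg_ge0 w K m; rewrite /u; lra.
have um1 : u m.+1 - u m <= w m.+2 + K.
  have : 0 <= K * m%:R by rewrite mulr_ge0.
  by have := defect_neg_ge0 w K m.+1; rewrite /u -[m.+1%:R]natr1; lra.
have {}uN : u N <= w m.+1 + N%:R * (w m.+2 + K).
  apply: (le_trans uN); apply: lerD => //.
  apply: (@le_trans _ _ ((N - m)%:R * (w m.+2 + K))); first by rewrite ler_wpM2l.
  by rewrite ler_wpM2r ?ler_nat ?leq_subr// addr_ge0// ltW.
have N0 : 0 <= N%:R :> R by [].
have bound (x : R) : 0 <= x ->
    4 * (w m.+1 + x * (w m.+2 + K) + K * x ^+ 2 + K) + K
    <= 4 * (x + 1) ^+ 2 * (w m.+1 + w m.+2 + 3 * K).
  move=> x0; have := w0 m.+1; have := w0 m.+2.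
  move: (w m.+1) (w m.+2) => c d /ltW c0 /ltW d0.
  have := mulr_ge0 x0 c0; have := mulr_ge0 x0 d0; have := mulr_ge0 x0 K0.
  have xx := mulr_ge0 x0 x0; have := mulr_ge0 xx c0; have := mulr_ge0 xx d0.
  by have := mulr_ge0 xx K0; lra.
(* If [defect_neg w K N] vanishes, [u N] controls [w N.+1]. Otherwise [w N.+1] cancels from [u N],
   leaving the mean of its two neighbours, which controls [w N]. *)
have [wN|wN] : w N.+1 <= u N + K * N%:R ^+ 2 \/
               w N <= 2 * (u N + K * N%:R ^+ 2 + K).
  rewrite /u /defect_neg; have [_|_] := leP (- defect w K N) 0; first by left; lra.
  by right; rewrite /defect; have := w0 N.+2; lra.
- have := bound _ N0; have := w0 N.+1; rewrite natr1.
  have := mulr_ge0 N0 (mulr_ge0 N0 K0); have := mulr_ge0 N0 K0.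
  by have := mulr_ge0 N0 (ltW (w0 m.+2)); have := w0 m.+1; lra.
(* Here [h2] passes from the controlled weight to the next one, at the cost of a factor 4 and a term
   [2 * K]. *)
- case: N mN h2 h1 uN N0 wN => // N mN h2 _ uN N0 wN.
  have := h2 N mN (ltnSn _); rewrite /defect; have := w0 N.
  by have := bound _ N0; rewrite natr1; lra.
Qed.
End ConcavityDefect.

(** * Logarithmic lower bounds and divergence *)

Lemma ln_sub_le (R : realType) (a b : R) : 0 < a -> 0 < b ->
  ln b - ln a <= (b - a) / a.
Proof.
move=> a0 b0; rewrite -ln_div ?posrE//.
have -> : b / a = 1 + (b - a) / a by field; rewrite gt_eqF.
apply: le_ln1Dx; rewrite mulrBl divff ?gt_eqF//.
by have := divr_gt0 b0 a0; lra.
Qed.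

Lemma nondecreasing_from (R : realType) (u : nat -> R) p :
  (forall n, (p <= n)%N -> u n <= u n.+1) ->
  forall n, (p <= n)%N -> u p <= u n.
Proof.
move=> uS n /subnK <-; elim: (n - p)%N => // k IH.
by apply: le_trans IH _; rewrite addSn uS// leq_addl.
Qed.

(** The sum is the largest distance to 0 that edge lengths [e j ^ (-1/2)] permit; the initial 1
    keeps it positive for logarithms and lets it absorb constants. *)
Definition length_sum (R : realType) (e : nat -> R) n :=
  1 + \sum_(j < n) (Num.sqrt (e j))^-1.

Lemma length_sumS (R : realType) (e : nat -> R) n :
  length_sum e n.+1 = length_sum e n + (Num.sqrt (e n))^-1.
Proof. by rewrite /length_sum big_ord_recr/= addrA. Qed.

Lemma length_sum_ge1 (R : realType) (e : nat -> R) n : 1 <= length_sum e n.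
Proof. by rewrite lerDl sumr_ge0// => j _; rewrite invr_ge0 sqrtr_ge0. Qed.

Lemma length_sum_homo (R : realType) (e : nat -> R) m n : (m <= n)%N ->
  length_sum e m <= length_sum e n.
Proof.
apply: nondecreasing_from => k _.
by rewrite length_sumS lerDl invr_ge0 sqrtr_ge0.
Qed.

Section Divergence.
Context {R : realType} (e : nat -> R) (e0 : forall n, 0 < e n).
Let h := length_sum e.
Variables (B : R) (p : nat).
Hypotheses (B0 : 0 < B)
  (eB : forall n, (p <= n)%N -> e n <= (B * n.+1%:R * h n) ^+ 2).

Let h0 n : 0 < h n.
Proof. exact: lt_le_trans ltr01 (length_sum_ge1 e n). Qed.

Let s0 n : 0 < Num.sqrt (e n). Proof. by rewrite sqrtr_gt0. Qed.

Let sB n : (p <= n)%N -> Num.sqrt (e n) <= B * n.+1%:R * h n.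
Proof.
move=> pn; rewrite -(@ler_pXn2r _ 2)// ?nnegrE ?(ltW (s0 n))//.
  by rewrite sqr_sqrtr ?eB// ltW.
by rewrite !mulr_ge0// ltW.
Qed.

(** The increment of [h n ^+ 2] is at least [2 * h n / sqrt (e n)], hence at least [2 / (B * n.+1)],
    which dominates [2 / B] times the increment of [ln n.+1]. *)
Lemma length_sum_unbounded L : exists2 n, (p <= n)%N & L <= h n.
Proof.
pose u n := h n ^+ 2 - 2 / B * ln n.+1%:R.
have uS n : (p <= n)%N -> u n <= u n.+1.
  move=> pn; have n0 : 0 < n.+1%:R :> R by rewrite ltr0n.
  have lnn : ln n.+2%:R - ln n.+1%:R <= n.+1%:R^-1 :> R.
    apply: le_trans (ln_sub_le n0 _) _; first by rewrite ltr0n.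
    by rewrite -natr1 addrAC subrr add0r mul1r.
  have hS : (B * n.+1%:R)^-1 <= h n * (Num.sqrt (e n))^-1.
    rewrite ler_pdivlMr// mulrC ler_pdivrMr ?mulr_gt0// mulrC.
    exact: sB.
  have : 2 / B * (ln n.+2%:R - ln n.+1%:R) <= 2 / B * n.+1%:R^-1.
    by rewrite ler_wpM2l// divr_ge0// ltW.
  rewrite /u /h length_sumS -/h.
  have : 0 <= (Num.sqrt (e n))^-1 ^+ 2 by rewrite sqr_ge0.
  move: hS; rewrite invfM; move: (h n) (Num.sqrt _)^-1 B^-1 n.+1%:R^-1.
  by move: (ln _) (ln _) => a b c d x y; lra.
(* Chosen so that [2 / B * X + u p = L ^+ 2]; [n] is then taken with [X <= ln n.+1]. *)
pose X := B / 2 * (L ^+ 2 - u p).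
pose n := maxn p (Num.bound (expR X)).
have pn : (p <= n)%N by rewrite leq_maxl.
exists n => //; have := nondecreasing_from uS pn.
have lnX : X <= ln n.+1%:R.
  rewrite -(expRK X) ler_ln ?posrE ?expR_gt0 ?ltr0n//.
  apply: (le_trans (ltW (archi_boundP (expR_ge0 X)))).
  by rewrite ler_nat leqW// leq_maxr.
have : 2 / B * X <= 2 / B * ln n.+1%:R by rewrite ler_wpM2l// divr_ge0// ltW.
rewrite {1}/X mulrA (_ : 2 / B * (B / 2) = 1); last by field; rewrite gt_eqF.
move=> H1 H2; have : L ^+ 2 <= h n ^+ 2.
  rewrite /u in H1 H2 *; move: H1 H2.
  by move: (ln _) (ln _) (h n) (h p) B^-1 => a b c d f; lra.
have [L0|L0] := leP L 0; first by move=> _; apply: le_trans L0 (ltW (h0 n)).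
by rewrite ler_pXn2r// nnegrE ltW.
Qed.

(** One factor [1 / sqrt (e n)] of [n.+1 / e n] is the increment of [h]; the other, times [n.+1], is
    at least [1 / (B * h n)]. So each term dominates the increment of [ln (h n) / B]. *)
Lemma series_nat_div_unbounded M :
  exists n, M <= \sum_(k < n) k.+1%:R / e k.
Proof.
pose v n := \sum_(k < n) k.+1%:R / e k.
have uS n : (p <= n)%N -> v n - ln (h n) / B <= v n.+1 - ln (h n.+1) / B.
  move=> pn; rewrite /v big_ord_recr/= -/(v n).
  have lnh := ln_sub_le (h0 n) (h0 n.+1).
  have hS : h n.+1 - h n = (Num.sqrt (e n))^-1.
    by rewrite /h length_sumS addrAC subrr add0r.
  have : (ln (h n.+1) - ln (h n)) / B <= n.+1%:R / e n.
    apply: (@le_trans _ _ ((Num.sqrt (e n))^-1 / h n / B)).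
      by rewrite -hS ler_wpM2r// invr_ge0 ltW.
    rewrite -{2}(sqr_sqrtr (ltW (e0 n))) expr2 invfM [leRHS]mulrCA -!mulrA.
    rewrite ler_wpM2l ?invr_ge0 ?sqrtr_ge0// -invfM.
    rewrite ler_pdivlMr// mulrC ler_pdivrMr ?mulr_gt0//.
    by rewrite (_ : _ * _ = B * n.+1%:R * h n) ?sB//; ring.
  by rewrite mulrBl; lra.
pose L := B * (M - (v p - ln (h p) / B)).
have [n pn hn] := length_sum_unbounded (expR L).
exists n; rewrite -/(v n).
have := nondecreasing_from uS pn.
have : L <= ln (h n) by rewrite -(expRK L) ler_ln ?posrE ?expR_gt0.
rewrite -(ler_pM2r (_ : 0 < B^-1)) ?invr_gt0//.
by rewrite /L mulrAC mulfV ?gt_eqF// mul1r; lra.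
Qed.
End Divergence.

(** * Curvature and intrinsic metrics on linear graphs *)

Section LinearGraph.
Context {R : realType} (G : weighted_graph R nat).
Hypotheses (hlin : linear_graph G) (hphys : physical G).

Let e k := weight G k k.+1.

Let e0 k : 0 < e k. Proof. by rewrite weight_gt0// hlin eqxx. Qed.

Let adj0 : [set y | adj G 0 y] = [set 1%N].
Proof. by apply/seteqP; split => y /=; rewrite hlin /= orbF => /eqP. Qed.

Let adjS n : [set y | adj G n.+1 y] = [set n] `|` [set n.+2].
Proof.
apply/seteqP; split => y /=; rewrite hlin eqSS.
  by move=> /orP[/eqP ->|/eqP ->]; [right|left].
by move=> [->|->]; rewrite eqxx ?orbT.
Qed.

Lemma linear_laplacian0 f : laplacian G f 0%N = e 0%N * (f 1%N - f 0%N).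
Proof. by rewrite /laplacian hphys invr1 mul1r adj0 fsbig_set1. Qed.

Lemma linear_laplacianS f n : laplacian G f n.+1 =
  e n.+1 * (f n.+2 - f n.+1) - e n * (f n.+1 - f n).
Proof.
rewrite /laplacian hphys invr1 mul1r adjS fsbigU//; last first.
  by move=> y [/= -> /eqP]; rewrite -addn2 -{1}[n]addn0 eqn_add2l.
by rewrite !fsbig_set1/= weight_sym -/(e n) -/(e n.+1); ring.
Qed.

(* The slopes beyond the neighbours of [k.+2] are repeated because this choice
   minimises Gamma2 at [k.+2] for given slopes [x] and [y] at [k.+2]. *)
Lemma CD_slopes (K : R) k : CD G (- K) +oo%E k.+2 -> forall x y,
  4 * e k.+1 * e k.+2 * x * y <=
  e k.+2 * (2 * e k.+2 - defect e K k.+1) * x ^+ 2 +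
  e k.+1 * (2 * e k.+1 - defect e K k) * y ^+ 2.
Proof.
move=> cd x y.
pose f i : R := if (i <= k.+2)%N then - ((k.+2 - i)%:R * y) else (i - k.+2)%:R * x.
have f0 : f k = - (2 * y) by rewrite /f leqW ?leqW// -addn2 addKn.
have f1 : f k.+1 = - y by rewrite /f leqW// subSnn mul1r.
have f2 : f k.+2 = 0 by rewrite /f leqnn subnn mul0r oppr0.
have f3 : f k.+3 = x by rewrite /f ltnn subSnn mul1r.
have f4 : f k.+4 = 2 * x by rewrite /f ltnNge leqW//= -[k.+4]addn2 addKn.
have := cd f; rewrite /Gamma2 /Gamma !linear_laplacianS/= !linear_laplacianS.
rewrite f0 f1 f2 f3 f4 /= /defect.
by move: (e k) (e k.+1) (e k.+2) (e k.+3) => a b c d; lra.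
Qed.

(** Slopes inverse to the weights give unit flux on both sides, so the test function is harmonic at
    [k.+2]; the terms without defects then cancel. *)
Lemma CD_defect (K : R) k : CD G (- K) +oo%E k.+2 ->
  e k.+1 * defect e K k.+1 + e k.+2 * defect e K k <= 0.
Proof.
move=> /CD_slopes/(_ (e k.+2)^-1 (e k.+1)^-1).
have e1 : e k.+1 != 0 by rewrite gt_eqF.
have e2 : e k.+2 != 0 by rewrite gt_eqF.
rewrite -(ler_pM2l (mulr_gt0 (e0 k.+1) (e0 k.+2))).
set D1 := defect _ _ _; set D2 := defect _ _ _.
have -> : e k.+1 * e k.+2 * (4 * e k.+1 * e k.+2 * (e k.+2)^-1 * (e k.+1)^-1) =
  4 * e k.+1 * e k.+2 by field; rewrite e1 e2.
have -> : e k.+1 * e k.+2 * (e k.+2 * (2 * e k.+2 - D1) * (e k.+2)^-1 ^+ 2 +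
  e k.+1 * (2 * e k.+1 - D2) * (e k.+1)^-1 ^+ 2) =
  e k.+1 * (2 * e k.+2 - D1) + e k.+2 * (2 * e k.+1 - D2) by field; rewrite e1 e2.
lra.
Qed.

(** The test function is constant to the right of [k.+2]. The result bounds [e k.+2] by
    [4 * e k.+1 + 2 * K]. *)
Lemma CD_defect_le (K : R) k : CD G (- K) +oo%E k.+2 ->
  defect e K k <= 2 * e k.+1.
Proof.
move=> /CD_slopes/(_ 0 1); rewrite expr1n expr0n/= !mulr0 !mulr1 add0r.
by rewrite pmulr_rge0// subr_ge0.
Qed.

Lemma Gamma_ge0 f n : 0 <= Gamma G f f n.+1.
Proof.
have -> : Gamma G f f n.+1 =
  2^-1 * (e n.+1 * (f n.+2 - f n.+1) ^+ 2 + e n * (f n.+1 - f n) ^+ 2).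
  by rewrite /Gamma !linear_laplacianS/=; field.
by rewrite mulr_ge0// addr_ge0// mulr_ge0 ?sqr_ge0// ltW.
Qed.

Lemma CD_le (K K' : R) D n : K' <= K -> CD G K D n.+1 -> CD G K' D n.+1.
Proof.
move=> KK cd f; apply: le_trans (cd f); rewrite lerD2l.
by rewrite ler_wpM2r// Gamma_ge0.
Qed.

(** A single term of the intrinsic condition already bounds the length of its edge; the triangle
    inequality along the path to 0 adds these bounds up. *)
Lemma intrinsic_le_length rho n : intrinsic_metric G rho ->
  rho n 0%N <= length_sum e n.
Proof.
move=> [rho0 rhoxx rhoC rhoD rhoint].
have step k : rho k.+1 k <= (Num.sqrt (e k))^-1.
  have ek : e k * rho k k.+1 ^+ 2 <= 1.
    rewrite -(hphys k); apply: le_trans (rhoint k).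
    have kk : [set y | adj G k y] k.+1 by rewrite /= hlin eqxx.
    rewrite (fsbigD1 k.+1)//=; last exact: adj_finite.
    rewrite -/(e k) lerDl fsumr_ge0// => y [ky _].
    by rewrite mulr_ge0 ?sqr_ge0// ltW// weight_gt0.
  have s0 : 0 < Num.sqrt (e k) by rewrite sqrtr_gt0.
  rewrite rhoC -[leRHS]mul1r ler_pdivlMr//.
  rewrite -(@ler_pXn2r _ 2)// ?nnegrE ?mulr_ge0 ?(ltW s0)//.
  by rewrite exprMn sqr_sqrtr ?(ltW (e0 k))// mulrC expr1n.
elim: n => [|n IH]; first by rewrite rhoxx (le_trans ler01)// length_sum_ge1.
by rewrite length_sumS addrC (le_trans (rhoD _ n _))// lerD.
Qed.

(** Since [length_sum] is nondecreasing, its value at the last vertex gives one curvature bound for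
    all earlier ones, as [quadratic_growth] requires. *)
Lemma weight_growth (C : R) m : 0 <= C ->
  (forall n, (m <= n)%N -> CD G (- (C * length_sum e n.+2 ^+ 2)) +oo%E n.+2) ->
  exists2 B, 0 < B & forall n, (m.+2 <= n)%N ->
    e n <= (B * n.+1%:R * length_sum e n) ^+ 2.
Proof.
move=> C0 cd; pose S := 8 * (e m.+1 + e m.+2 + 3 * C).
have S0 : 0 < S by have := e0 m.+1; have := e0 m.+2; rewrite /S; lra.
(* The estimate yields the factor [S], and [S <= (1 + S) ^+ 2]. *)
exists (1 + S) => [|[//|N] mN]; first by rewrite addr_gt0.
set h := length_sum e; have h1 n : 1 <= h n ^+ 2.
  exact/exprn_ege1/length_sum_ge1.
pose K := C * h N.+1 ^+ 2.
have K0 : 0 <= K by rewrite mulr_ge0// sqr_ge0.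
have cdK k : (m <= k)%N -> (k < N)%N -> CD G (- K) +oo%E k.+2.
  move=> mk kN; apply: CD_le (cd k mk); rewrite lerN2 ler_wpM2l//.
  rewrite lerXn2r ?nnegrE ?(le_trans ler01) ?length_sum_ge1//.
  exact: length_sum_homo.
have : e N.+1 <= 8 * N.+1%:R ^+ 2 * (e m.+1 + e m.+2 + 3 * K).
  apply: quadratic_growth => // k mk kN; first exact: CD_defect (cdK k mk kN).
  exact: CD_defect_le (cdK k mk kN).
move=> /le_trans; apply; rewrite !exprMn.
have N1 : N.+1%:R ^+ 2 <= N.+2%:R ^+ 2 :> R.
  by rewrite lerXn2r ?nnegrE ?ler0n// ler_nat.
apply: (@le_trans _ _ (S * N.+1%:R ^+ 2 * h N.+1 ^+ 2)).
  rewrite /K /S; set X := N.+1%:R ^+ 2; set H := h N.+1 ^+ 2.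
  rewrite (_ : 8 * _ * X * H = 8 * X * ((e m.+1 + e m.+2 + 3 * C) * H)); last by ring.
  rewrite ler_wpM2l ?mulr_ge0 ?sqr_ge0//.
  have := ler_wpM2l (ltW (e0 m.+1)) (h1 N.+1).
  by have := ler_wpM2l (ltW (e0 m.+2)) (h1 N.+1); rewrite -/H; lra.
rewrite ler_wpM2r ?sqr_ge0// ler_pM// ?sqr_ge0 ?(ltW S0)//.
by have := sqr_ge0 S; lra.
Qed.
End LinearGraph.

(** * Stochastic completeness from the curvature bound *)

Unset Implicit Arguments.
Set Strict Implicit.

Theorem theorem1p6 (R : realType) (G : weighted_graph R nat)
    (hlin : linear_graph G) (hphys : physical G)
    (rho : nat -> nat -> R) (hrho : intrinsic_metric G rho)
    (hK : exists C : R, \forall n \near \oo,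
       (maxe (- curvature G +oo n) 0 <= (C * rho n 0%N ^+ 2)%:E)%E) :
  stochastically_complete G.
Proof.
have [C [m _ Cm]] := hK.
pose e k := weight G k k.+1; pose h := length_sum e.
have e0 k : 0 < e k by rewrite weight_gt0// hlin eqxx.
have C1 : 0 <= `|C| + 1 by rewrite addr_ge0.
have cd n : (m <= n)%N -> CD G (- ((`|C| + 1) * h n.+2 ^+ 2)) +oo%E n.+2.
  move=> mn; have /= := Cm n.+2 (leqW (leqW mn)).
  rewrite ge_max => /andP[Cn _].
  (* The added 1 makes the inequality strict, so some admissible [K'] lies above the bound whether
     or not the supremum is attained. *)
  have : ((- ((`|C| + 1) * h n.+2 ^+ 2))%:E < curvature G +oo n.+2)%E.
    rewrite EFinN lteNl; apply: le_lt_trans Cn _; rewrite lte_fin.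
    have h1 : 0 < h n.+2 ^+ 2.
      by rewrite exprn_gt0// (lt_le_trans ltr01)// length_sum_ge1.
    apply: (@le_lt_trans _ _ (`|C| * h n.+2 ^+ 2)); last by rewrite mulrDl mul1r ltrDl.
    have [rho0 _ _ _ _] := hrho.
    apply: (@le_trans _ _ (`|C| * rho n.+2 0%N ^+ 2)).
      by rewrite ler_wpM2r ?sqr_ge0// ler_norm.
    rewrite ler_wpM2l// lerXn2r ?nnegrE ?rho0//.
      by rewrite (le_trans ler01)// length_sum_ge1.
    exact: intrinsic_le_length.
  move=> /ereal_sup_gt[_ [K' cdK' <-]]; rewrite lte_fin => /ltW KK.
  exact (CD_le hlin hphys KK cdK').
have [B B0 eB] := weight_growth hlin hphys C1 cd.
(* The flux [e n * (v n.+1 - v n) = n.+1] grows by one at each vertex, so the Laplacian of [v] is 1,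
   also at 0 where only the outgoing flux counts. *)
pose v n := \sum_(k < n) k.+1%:R / e k.
have vS n : v n.+1 - v n = n.+1%:R / e n.
  by rewrite /v big_ord_recr/= addrAC subrr add0r.
apply: (stochastically_complete_exhausting (v := v)) => [n|[|n]|M].
- by apply: sumr_ge0 => k _; rewrite divr_ge0// ltW.
- by rewrite linear_laplacian0// vS -/(e 0%N) mulrCA divff ?mulr1// gt_eqF.
- rewrite linear_laplacianS// !vS -/(e n.+1) -/(e n).
  rewrite mulrCA divff ?gt_eqF// mulrCA divff ?gt_eqF//.
  by rewrite !mulr1 -[n.+2%:R]natr1 addrAC subrr add0r.
(* As [v] is nondecreasing, one value above [M] confines the sublevel set to an initial segment. *)
have [n vn] := series_nat_div_unbounded e0 B0 eB M.
apply: sub_finite_set (finite_II n) => k /= vk; rewrite ltnNge.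
apply/negP => nk; move: vk; apply/negP; rewrite -leNgt (le_trans vn)//.
apply: (@nondecreasing_from _ v n) => // j _.
by rewrite -subr_ge0 vS divr_ge0// ltW.
Qed.
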